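(* Let $\mathcal{S}$ be a semi-primitive linear subspace of $\mathrm{Mat}_{m,n}(\mathbb{K})$. Set $r:=\mathrm{urk}(\mathcal{S})$ and assume $\#\mathbb{K}>r\geq 2$. Then $\mathrm{trk}(\mathcal{S})\leq 6+\binom{r-2}{2}$.
   Context: $\mathrm{urk}$ is the maximal rank of a matrix in the space; $\mathrm{trk}(\mathcal{S}):=\max_{x\in\mathbb{K}^n}\dim\{Mx\mid M\in\mathcal{S}\}$. For an operator space $\mathcal{T}\subseteq\mathcal{L}(U,V)$: $\mathcal{T}$ is reduced if $\bigcap_{f\in\mathcal{T}}\ker f=\{0\}$ and $\sum_{f\in\mathcal{T}}\mathrm{im} f=V$; $\mathcal{T}$ is $c$-defective if $\dim\ker f\geq c$ for all $f\in\mathcal{T}$; its defectiveness index is the greatest such $c$; $\mathcal{T}$ is semi-primitive if it is reduced and there is no linear hyperplane $U'$ of $U$ such that $\{f_{|U'}\mid f\in\mathcal{T}\}$ is $c$-defective, $c$ being the defectiveness index of $\mathcal{T}$. A matrix space in $\mathrm{Mat}_{m,n}(\mathbb{K})$ is semi-primitive if the corresponding subspace of $\mathcal{L}(\mathbb{K}^n,\mathbb{K}^m)$ is. *)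

(* Defs.v *)
From HB Require Import structures.
From mathcomp Require Import all_boot all_order all_algebra.
From Stdlib Require Import Classical ClassicalEpsilon.
Set Implicit Arguments. Unset Strict Implicit. Unset Printing Implicit Defensive.
Import GRing.Theory.
Local Open Scope ring_scope.

Lemma decP_ex (P : Prop) : exists b : bool, b = true <-> P.
Proof.
case: (classic P) => HP; [exists true | exists false]; split => // H; case: (HP H).
Qed.

Definition decP (P : Prop) : bool :=
  proj1_sig (constructive_indefinite_description _ (decP_ex P)).

(* Largest k <= b satisfying P (0 if none). *)
Definition natmax (P : nat -> Prop) (b : nat) : nat :=
  (\max_(k < b.+1 | decP (P k)) (k : nat))%N.

Section Defs.
Variables (K : fieldType) (m n : nat).

Definition opker (M : 'M[K]_(m, n)) : {vspace 'cV[K]_n} :=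
  lker (linfun (mulmx M : 'cV[K]_n -> 'cV[K]_m)).

(* urk S: maximal rank of a matrix of S (ranks are <= minn m n). *)
Definition urk (S : {vspace 'M[K]_(m, n)}) : nat :=
  natmax (fun k => exists2 M, M \in S & \rank M = k) (minn m n).

Definition evalsp (S : {vspace 'M[K]_(m, n)}) (x : 'cV[K]_n) : {vspace 'cV[K]_m} :=
  (linfun (mulmxr x : 'M[K]_(m, n) -> 'cV[K]_m) @: S)%VS.

(* trk S := max_x dim {M x | M in S} (dimensions are <= m). *)
Definition trk (S : {vspace 'M[K]_(m, n)}) : nat :=
  natmax (fun k => exists x : 'cV[K]_n, \dim (evalsp S x) = k) m.

Definition reduced (S : {vspace 'M[K]_(m, n)}) : Prop :=
  (forall x : 'cV[K]_n, (forall M, M \in S -> M *m x = 0) -> x = 0) /\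
  (forall y : 'cV[K]_m, exists (k : nat) (Ms : 'I_k -> 'M[K]_(m, n))
       (xs : 'I_k -> 'cV[K]_n),
       (forall i, Ms i \in S) /\ y = \sum_(i < k) Ms i *m xs i).

Definition defective (S : {vspace 'M[K]_(m, n)}) (c : nat) : Prop :=
  forall M, M \in S -> (c <= \dim (opker M))%N.

(* Defectiveness index: greatest c such that S is c-defective (c <= n). *)
Definition defect_index (S : {vspace 'M[K]_(m, n)}) : nat :=
  natmax (defective S) n.

(* Semi-primitive: reduced, and no linear hyperplane U' of K^n such that
   {f_|U'} is c-defective, c the defectiveness index of S.
   ker (f_|U') = U' :&: ker f. *)
Definition semi_primitive (S : {vspace 'M[K]_(m, n)}) : Prop :=
  reduced S /\
  ~ (exists U' : {vspace 'cV[K]_n},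
       (\dim U').+1 = n /\
       forall M, M \in S -> (defect_index S <= \dim (U' :&: opker M)%VS)%N).

End Defs.

(* Main.v *)
Require Import Defs.
From HB Require Import structures.
From mathcomp Require Import all_boot all_order all_algebra.
From mathcomp Require Import zify.
From Stdlib Require Import Classical ClassicalEpsilon.
Set Implicit Arguments. Unset Strict Implicit. Unset Printing Implicit Defensive.
Import GRing.Theory.
Local Open Scope ring_scope.

(** The proof gives the stronger bound [4 trk S <= (r + 1)^2], by induction on
    [r].  Extending scalars to [K(t)], possible because [#K > r], one may argue
    with generic elements of S.  Semi-primitivity says that the kernels of the
    rank [r] elements span the source.  Fix such an element J, a vector x of its
    kernel with [W := S x] nonzero, and G with [J G J = J].  As no [J + s M] has
    rank above [r], every [(M G)^j M] maps ker J into im J; in particular W lies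
    in im J.
    - If [W = im J], polarizing these relations gives
      [dim S z <= max r (2 r - 2)] for all z.
    - Otherwise, S modulo W or S modulo im J has maximal rank at most [r - 2]
      and inherits the spanning property, so that induction gives
      [4 dim S z <= 4 r + (r - 1)^2 = (r + 1)^2].  Indeed, suppose that both
      maximal ranks are at least [r - 1].  For generic M, the map induced by
      [M G] from im J to the quotient by im J has the line of [M x] as kernel.
      Hence M sends ker J and [G M x] into W, and, the kernels modulo W spanning
      the source, it may be chosen to send also some v with [J v] outside W into
      W.  So M has rank at most [r - 2] modulo W, a contradiction. *)

(** * Determinants and ranks along a pencil of matrices *)

Section Pencil.
Variable F : fieldType.

Definition pencil_poly k (A B : 'M[F]_k) : {poly F} :=
  \det (map_mx polyC A + 'X *: map_mx polyC B).

Lemma horner_pencil k (A B : 'M[F]_k) (s : F) :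
  (pencil_poly A B).[s] = \det (A + s *: B).
Proof.
rewrite /pencil_poly -horner_evalE -det_map_mx; congr (\det _).
by apply/matrixP => i j; rewrite !mxE /= ?/horner_eval hornerD hornerM hornerX !hornerC.
Qed.

(** Once [B] is reduced to the diagonal form [pid_mx (\rank B)], the last row of the pencil is
    constant, so every Leibniz term has degree at most [k]. *)
Lemma size_pencil k (A B : 'M[F]_k.+1) :
  (\rank B <= k)%N -> (size (pencil_poly A B) <= k.+1)%N.
Proof.
move=> rB.
pose C := col_ebase B; pose R := row_ebase B.
have uC : C \in unitmx := col_ebase_unit B.
have uR : R \in unitmx := row_ebase_unit B.
pose A' := invmx C *m A *m invmx R.
have -> : pencil_poly A B =
    \det (map_mx polyC C) * pencil_poly A' (pid_mx (\rank B)) * \det (map_mx polyC R).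
  rewrite /pencil_poly -!det_mulmx; congr (\det _).
  rewrite mulmxDr mulmxDl -scalemxAr -scalemxAl -!map_mxM /= mulmx_ebase.
  by rewrite /A' !mulmxA mulmxV // mul1mx mulmxKV.
rewrite !det_map_mx mul_polyC mulrC mul_polyC.
do 2!apply: leq_trans (size_scale_leq _ _) _.
rewrite /pencil_poly; set Z := (_ + _); rewrite /determinant; apply: (leq_trans (size_sum _ _ _)).
apply/bigmax_leqP => s _; rewrite -signr_odd.
set P := (\prod_i _).
apply: (@leq_trans (size P)).
  by case: (odd _); rewrite ?expr1 ?mulN1r ?size_polyN // expr0 mul1r.
apply: (leq_trans (size_prod_leq _ _)).
set T := (\sum_(i | _) _)%N.
suff : (T <= k.+1 + k)%N by rewrite cardT size_enum_ord; lia.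
rewrite /T big_ord_recr /=.
have H1 i j : (size (Z i j) <= 2)%N.
  rewrite !mxE mulrC mul_polyC; apply: leq_trans (size_polyD _ _) _.
  rewrite geq_max (leq_trans (size_polyC_leq1 _)) //.
  by rewrite (leq_trans (size_scale_leq _ _)) // size_polyX.
have H2 j : (size (Z ord_max j) <= 1)%N.
  rewrite !mxE /= [(k < _)%N]ltnNge rB andbF /= mulr0 addr0.
  exact: size_polyC_leq1.
apply: (@leq_trans (\sum_(i < k) 2 + 1)); last by rewrite sum_nat_const card_ord; lia.
by apply: leq_add => //; apply: leq_sum => i _.
Qed.

Lemma rank_certificate n m k (A : 'M[F]_(n, m)) :
  (k <= \rank A)%N -> exists P Q, P *m A *m Q = 1%:M :> 'M_k.
Proof.
move=> kA.
exists (pid_mx k *m invmx (col_ebase A)), (invmx (row_ebase A) *m pid_mx k).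
rewrite -[X in _ *m X *m _]mulmx_ebase !mulmxA mulmxKV ?col_ebase_unit //.
rewrite mulmxK ?row_ebase_unit // !mul_pid_mx -pid_mx_1; congr pid_mx.
by have := rank_leq_row A; have := rank_leq_col A; lia.
Qed.

Lemma rank_of_certificate n m k (A : 'M[F]_(n, m)) (P : 'M_(k, n)) (Q : 'M_(m, k)) :
  \det (P *m A *m Q) != 0 -> (k <= \rank A)%N.
Proof.
rewrite -unitfE -[_ \is a _]/(_ \in unitmx) => /mxrank_unit <-.
by rewrite (leq_trans (mxrankM_maxl _ _)) // mxrankM_maxr.
Qed.

(** A larger rank at [c] would be certified by a nonzero polynomial of degree at most [r], since [Y]
    has rank at most [r]; it would vanish at the more than [r] points of [s]. *)
Lemma rank_pencil n m r (X Y : 'M[F]_(n, m)) (s : seq F) :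
  uniq s -> (r < size s)%N -> (\rank Y <= r)%N ->
  (forall a, a \in s -> \rank (X + a *: Y)%R <= r)%N ->
  forall c, (\rank (X + c *: Y)%R <= r)%N.
Proof.
move=> us rs rY rs' c; case: (leqP (\rank (X + c *: Y)%R) r) => // lt.
have [P [Q PQ]] := rank_certificate lt.
pose p := pencil_poly (P *m X *m Q) (P *m Y *m Q).
have pE a : p.[a] = \det (P *m (X + a *: Y) *m Q).
  by rewrite horner_pencil mulmxDr mulmxDl -scalemxAr -scalemxAl.
have p0 : p != 0.
  apply/eqP => p0; move: (pE c); rewrite PQ det1 p0 horner0 => /eqP.
  by rewrite eq_sym oner_eq0.
have /(max_poly_roots p0) : all (root p) s.
  apply/allP => a /rs' ra; rewrite /root pE; apply: contraTT ra => /rank_of_certificate.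
  by rewrite -ltnNge.
move=> /(_ us); rewrite ltnNge => /negP[]; apply: leq_trans rs.
apply: size_pencil; apply: leq_trans rY.
by rewrite (leq_trans (mxrankM_maxl _ _)) // mxrankM_maxr.
Qed.

End Pencil.

(** * Generic points over an infinite field, and resolvent identities *)

Section Generic.
Variables (F : fieldType) (k : nat).
Hypothesis infF : forall p : {poly F}, p != 0 -> exists s, p.[s] != 0.

Lemma infinite_poly_eq0 (p : {poly F}) : (forall s, p.[s] = 0) -> p = 0.
Proof.
by move=> p0; apply/eqP/negP => /negP /infF[s]; rewrite p0 eqxx.
Qed.

(** Polynomiality on each line replaces multivariate polynomials: it is enough to intersect the
    nonempty open sets [D != 0] that define [generic]. *)
Definition line_poly (D : 'rV[F]_k -> F) :=
  forall c d, exists p : {poly F}, forall s, D (c + s *: d) = p.[s].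

Definition generic (P : 'rV[F]_k -> Prop) :=
  exists D, [/\ line_poly D, exists c, D c != 0 & forall c, D c != 0 -> P c].

Lemma generic_ex P : generic P -> exists c, P c.
Proof. by case=> D [_ [c Dc] /(_ c Dc)]; exists c. Qed.

Lemma generic_and P Q : generic P -> generic Q -> generic (fun c => P c /\ Q c).
Proof.
case=> D [lD [c Dc] DP] [E [lE [d Ed] EQ]]; exists (fun c => D c * E c); split.
- move=> u v; have [[p pE] [q qE]] := (lD u v, lE u v).
  by exists (p * q) => s; rewrite pE qE hornerM.
(* On the line joining [c] to [d] neither restriction is the zero polynomial, hence neither is their
   product. *)
- have [[p pE] [q qE]] := (lD c (d - c), lE c (d - c)).
  have p0 : p != 0.
    by apply: contraNneq Dc => p0; rewrite -[c]addr0 -(scale0r (d - c)) pE p0 horner0.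
  have q0 : q != 0.
    by apply: contraNneq Ed => q0; rewrite -[d](subrK c) addrC -(scale1r (d - c)) qE q0 horner0.
  have [s] := infF (mulf_neq0 p0 q0); rewrite hornerM -pE -qE => DE.
  by exists (c + s *: (d - c)).
by move=> u; rewrite mulf_eq0 negb_or => /andP[/DP ? /EQ].
Qed.

Definition affine n m (f : 'rV[F]_k -> 'M[F]_(n, m)) :=
  forall c d, exists Y, forall s, f (c + s *: d) = f c + s *: Y.

Lemma generic_rank n m (f : 'rV[F]_k -> 'M[F]_(n, m)) r c :
  affine f -> (r <= \rank (f c))%N -> generic (fun c => r <= \rank (f c))%N.
Proof.
move=> af /rank_certificate[P [Q PQ]].
exists (fun c => \det (P *m f c *m Q)); split; last by move=> d /rank_of_certificate.
- move=> u v; have [Y fY] := af u v; exists (pencil_poly (P *m f u *m Q) (P *m Y *m Q)) => s.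
  by rewrite horner_pencil fY mulmxDr mulmxDl -scalemxAr -scalemxAl.
by exists c; rewrite PQ det1 oner_eq0.
Qed.

(** Replacing the inverse by the adjugate gives a polynomial in [s], which must vanish identically;
    its value at 0 is [x *m R]. *)
Lemma resolvent_eq0 n p (x : 'rV[F]_n) (Y : 'M_n) (R : 'M_(n, p)) :
  (forall s, s != 0 -> 1%:M + s *: Y \in unitmx ->
     x *m invmx (1%:M + s *: Y) *m R = 0) ->
  x *m R = 0.
Proof.
move=> H; apply/rowP => j; rewrite [RHS]mxE.
pose Z : 'M[{poly F}]_n := map_mx polyC 1%:M + 'X *: map_mx polyC Y.
pose q := (map_mx polyC x *m \adj Z *m map_mx polyC R) 0 j.
have qE s : q.[s] = (x *m \adj (1%:M + s *: Y) *m R) 0 j.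
  have ZE : map_mx (horner_eval s) Z = 1%:M + s *: Y.
    by apply/matrixP => a b; rewrite !mxE /= ?/horner_eval hornerD hornerM hornerX !hornerC.
  have polyCE a b (A : 'M[F]_(a, b)) : map_mx (horner_eval s) (map_mx polyC A) = A.
    by apply/matrixP => u v; rewrite !mxE /= /horner_eval hornerC.
  rewrite -[LHS]/(horner_eval s q) /q.
  transitivity ((map_mx (horner_eval s) (map_mx polyC x *m \adj Z *m map_mx polyC R)) 0 j).
    by rewrite [RHS]mxE.
  by rewrite !map_mxM map_mx_adj ZE !polyCE.
(* The determinant takes care of the singular values of [s], and ['X] of the excluded value 0. *)
have : q * pencil_poly 1%:M Y * 'X = 0.
  apply: infinite_poly_eq0 => s; rewrite !hornerM hornerX horner_pencil qE.
  have [-> | s0] := eqVneq s 0; first by rewrite mulr0.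
  case: (boolP (1%:M + s *: Y \in unitmx)) => [uZ | ]; last first.
    by rewrite unitmxE unitfE negbK => /eqP ->; rewrite mulr0 mul0r.
  have := H s s0 uZ; rewrite /invmx uZ -scalemxAr -scalemxAl => /eqP.
  rewrite scaler_eq0 invr_eq0 -[_ == 0]negbK -unitfE -unitmxE uZ /= => /eqP ->.
  by rewrite mxE !mul0r.
move/eqP; rewrite !mulf_eq0 polyX_eq0 orbF => /orP[/eqP q0 | /eqP p0].
  move: (qE 0); rewrite q0 horner0 scale0r addr0 => ->.
  by rewrite -[\adj _]mul1mx mul_mx_adj det1 mulmx1.
move: (horner_pencil 1%:M Y 0); rewrite p0 horner0 scale0r addr0 det1 => /eqP.
by rewrite eq_sym oner_eq0.
Qed.

(** Writing [s *: Y] as [(1 + s *: Y) - 1] reduces the claim to the hypothesis and [x *m R = 0].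
    Iteration yields [x Y^j R = 0]. *)
Lemma resolvent_shift n p (x : 'rV[F]_n) (Y : 'M_n) (R : 'M_(n, p)) :
  (forall s, s != 0 -> 1%:M + s *: Y \in unitmx ->
     x *m invmx (1%:M + s *: Y) *m R = 0) ->
  forall s, s != 0 -> 1%:M + s *: Y \in unitmx ->
     x *m invmx (1%:M + s *: Y) *m (Y *m R) = 0.
Proof.
move=> H s s0 uZ; have xR := resolvent_eq0 H.
apply/eqP; rewrite -(inj_eq (scalerI s0)) scaler0 scalemxAr scalemxAl.
set Z := 1%:M + s *: Y in uZ *; have -> : s *: Y = Z - 1%:M by rewrite addrC addKr.
by rewrite mulmxBl mulmxBr !mulmxA mulmxKV // mulmx1 xR H // subr0.
Qed.

(* [J + s M = (1 + s M G) J + s M (1 - G J)]: as the rank of this pencil never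
   exceeds that of [J], [(1 + s M G)^-1 M] sends ker J into im J. *)
Lemma krylov_annihilation n m p (J M : 'M[F]_(n, m)) (G : 'M_(m, n)) (Q : 'M_(m, p))
    (x : 'rV_n) :
  J *m G *m J = J -> (forall s, \rank (J + s *: M)%R <= \rank J)%N ->
  J *m Q = 0 -> x *m J = 0 ->
  [/\ x *m M *m Q = 0, x *m M *m G *m M *m Q = 0
    & x *m M *m G *m M *m G *m M *m Q = 0].
Proof.
move=> JGJ rJ JQ xJ; pose R := M *m (1%:M - G *m J).
have H s : s != 0 -> 1%:M + s *: (M *m G) \in unitmx ->
    x *m invmx (1%:M + s *: (M *m G)) *m R = 0.
  move=> s0 uZ; set T := invmx _.
  pose X := J + s *: (T *m R).
  have XE : X = T *m (J + s *: M).
    rewrite /X -[J in LHS](mulKmx uZ) -/T [s *: (T *m R)]scalemxAr -mulmxDr; congr (_ *m _).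
    rewrite mulmxDl mul1mx -addrA; congr (_ + _).
    by rewrite -scalemxAl -scalerDr /R mulmxBr mulmx1 mulmxA addrC subrK.
  have XGJ : X *m (G *m J) = J.
    have GJ2 : (1%:M - G *m J) *m (G *m J) = 0.
      by rewrite mulmxBl mul1mx -mulmxA [J *m _]mulmxA JGJ subrr.
    by rewrite mulmxDl mulmxA JGJ -scalemxAl /R -!mulmxA GJ2 !mulmx0 scaler0 addr0.
  (* As [X] has rank at most that of [J], multiplication by [G *m J] is injective on its row space;
     it kills [x *m X], which is therefore 0. *)
  have := mxrank_mul_ker X (G *m J); rewrite XGJ => rX.
  have rX' : (\rank X <= \rank J)%N by rewrite XE (leq_trans (mxrankM_maxr _ _)).
  have /eqP : \rank (X :&: kermx (G *m J))%MS = 0%N by lia.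
  rewrite mxrank_eq0 => /eqP cap0.
  have : (x *m X <= X :&: kermx (G *m J))%MS.
    by rewrite sub_capmx submxMl sub_kermx -mulmxA XGJ xJ eqxx.
  rewrite cap0 submx0 mulmxDr xJ add0r -scalemxAr scaler_eq0 (negPf s0) /=.
  by rewrite mulmxA => /eqP.
have QE : (1%:M - G *m J) *m Q = Q by rewrite mulmxBl mul1mx -mulmxA JQ mulmx0 subr0.
have H1 := resolvent_shift H; have H2 := resolvent_shift H1.
have := resolvent_eq0 H; have := resolvent_eq0 H1; have := resolvent_eq0 H2.
move=> E2 E1 E0; split.
- by move/(congr1 (mulmx^~ Q)): E0; rewrite mul0mx /R -!mulmxA QE.
- by move/(congr1 (mulmx^~ Q)): E1; rewrite mul0mx /R -!mulmxA QE.
by move/(congr1 (mulmx^~ Q)): E2; rewrite mul0mx /R -!mulmxA QE.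
Qed.

End Generic.

(** * Matrix families, their evaluations and their kernels *)

Section Family.
Variables (F : fieldType) (n m k : nat).
Implicit Types (b : 'I_k -> 'M[F]_(n, m)) (c : 'rV[F]_k) (x : 'rV[F]_n).

Definition comb b c : 'M[F]_(n, m) := \sum_i c 0 i *: b i.
Definition evalmx b x : 'M[F]_(k, m) := \matrix_i (x *m b i).

(* A matrix acts on row vectors, so [b] spans the transpose of the space of
   the statement, and kernels are left kernels. *)
Definition kernel_spanning b r :=
  (forall c, \rank (comb b c) <= r)%N /\
  forall l : 'cV_n, l != 0 ->
    exists c x, [/\ \rank (comb b c) = r, x *m comb b c = 0 & x *m l != 0].

Lemma mul_evalmx b c x : c *m evalmx b x = x *m comb b c.
Proof.
rewrite mulmx_sum_row mulmx_sumr; apply: eq_bigr => i _.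
by rewrite rowK scalemxAr.
Qed.

Lemma combD b c d : comb b (c + d) = comb b c + comb b d.
Proof. by rewrite -big_split; apply: eq_bigr => i _; rewrite mxE scalerDl. Qed.

Lemma combZ b a c : comb b (a *: c) = a *: comb b c.
Proof. by rewrite scaler_sumr; apply: eq_bigr => i _; rewrite mxE scalerA. Qed.

Lemma combMr b (P : 'M_m) c : comb (fun i => b i *m P) c = comb b c *m P.
Proof. by rewrite mulmx_suml; apply: eq_bigr => i _; rewrite scalemxAl. Qed.

Lemma evalmxMr b (P : 'M_m) x : evalmx (fun i => b i *m P) x = evalmx b x *m P.
Proof. by apply/row_matrixP => i; rewrite rowK row_mul rowK mulmxA. Qed.

Lemma affine_combM b p q (L : 'M_(p, n)) (P : 'M_(m, q)) :
  affine (fun c => L *m comb b c *m P).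
Proof.
move=> c d; exists (L *m comb b d *m P) => s.
by rewrite combD combZ mulmxDr mulmxDl -scalemxAr -scalemxAl.
Qed.

Lemma affine_row_mx b q (P : 'M_(m, q)) (l : 'cV_n) :
  affine (fun c => row_mx (comb b c *m P) l).
Proof.
move=> c d; exists (row_mx (comb b d *m P) 0) => s.
by rewrite combD combZ mulmxDl scale_row_mx scaler0 add_row_mx addr0 -scalemxAl.
Qed.

(** This turns the presence of a kernel vector outside a hyperplane into a rank condition, which can
    then be made generic. *)
Lemma rank_row_mx_gt p (A : 'M[F]_(n, p)) (l : 'cV_n) :
  (\rank A < \rank (row_mx A l))%N <-> exists2 x : 'rV_n, x *m A = 0 & x *m l != 0.
Proof.
split=> [lt | [x xA xl]].
  case: (eqVneq (kermx A *m l) 0) => [Kl | Kl].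
    have : (kermx A <= kermx (row_mx A l))%MS.
      by apply/sub_kermxP; rewrite mul_mx_row mulmx_ker Kl row_mx0.
    move/mxrankS; rewrite !mxrank_ker.
    have := rank_leq_row (row_mx A l); lia.
  have [i Ki] : exists i, row i (kermx A *m l) != 0.
    apply: not_all_not_ex => K0; case/eqP: Kl; apply/row_matrixP => i.
    by move/negP: (K0 i); rewrite negbK row0 => /eqP.
  by exists (row i (kermx A)); rewrite -row_mul // mulmx_ker row0.
have : (kermx (row_mx A l) < kermx A)%MS.
  rewrite ltmxE; apply/andP; split.
    apply/sub_kermxP.
    by move: (mulmx_ker (row_mx A l)); rewrite mul_mx_row -row_mx0 => /eq_row_mx[].
  apply: contra xl => sK.
  have /sub_kermxP : (x <= kermx (row_mx A l))%MS.
    by rewrite (submx_trans _ sK) //; apply/sub_kermxP.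
  by rewrite mul_mx_row -row_mx0 => /eq_row_mx[_ ->].
move/rank_ltmx; rewrite !mxrank_ker; lia.
Qed.

(** Multiplying by [P] passes to a quotient of the target. A generic element keeps a kernel vector
    outside [l = 0] and has maximal rank after [P], and [P] only enlarges its kernel. *)
Lemma kernel_spanning_mulmx b r (P : 'M_m) :
    (forall p : {poly F}, p != 0 -> exists s, p.[s] != 0) ->
  kernel_spanning b r ->
  exists c, kernel_spanning (fun i => b i *m P) (\rank (comb b c *m P)).
Proof.
move=> infF [rb sb].
have [c0 c0P] : exists c0, forall c, (\rank (comb b c *m P) <= \rank (comb b c0 *m P))%N.
  apply: NNPP => noP.
  suff /(_ m.+1)[c] : forall j, exists c, (j <= \rank (comb b c *m P))%N.
    by rewrite ltnNge rank_leq_col.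
  elim=> [|j [c jc]]; first by exists 0.
  have [d] := not_all_ex_not _ _ (not_ex_all_not _ _ noP c) => /negP.
  by rewrite -ltnNge => lt; exists d; apply: leq_ltn_trans lt.
exists c0; split=> [c|l l0]; first by rewrite combMr.
have [c1 [x [r1 xc1 xl]]] := sb l l0.
have gl : (r < \rank (row_mx (comb b c1 *m 1%:M) l))%N.
  by rewrite -r1 mulmx1; apply/rank_row_mx_gt; exists x.
have gP : (\rank (comb b c0 *m P) <= \rank (1%:M *m comb b c0 *m P))%N by rewrite mul1mx.
have [c []] := generic_ex (generic_and infF (generic_rank (affine_row_mx _ _ _) gl)
                                    (generic_rank (affine_combM _ _ _) gP)).
rewrite mulmx1 mul1mx => cl cP.
have /rank_row_mx_gt[y yc yl] : (\rank (comb b c) < \rank (row_mx (comb b c) l))%N.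
  exact: leq_ltn_trans (rb c) cl.
exists c, y; rewrite combMr mulmxA yc mul0mx; split=> //.
by apply/eqP; rewrite eqn_leq c0P.
Qed.

End Family.

Lemma rank1_submx (F : fieldType) m p (T : 'M[F]_(p, m)) (v : 'rV_m) :
  (\rank T <= 1)%N -> v != 0 -> (v <= T)%MS -> (T <= v)%MS.
Proof.
move=> T1 v0 vT; have := mxrank_leqif_sup vT; rewrite /leqif => -[_ <-].
by rewrite eqn_leq mxrankS //= (leq_trans T1) // lt0n mxrank_eq0.
Qed.

(** * An element [J] of maximal rank and a vector of its kernel *)

Section KernelVector.
Variables (F : fieldType) (n m k : nat).
Hypothesis infF : forall p : {poly F}, p != 0 -> exists s, p.[s] != 0.
Variables (b : 'I_k -> 'M[F]_(n, m)) (c0 : 'rV[F]_k).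
Let J := comb b c0.
Hypothesis maxJ : forall c, (\rank (comb b c) <= \rank J)%N.
Let r := \rank J.
Variables (G : 'M[F]_(m, n)) (Q : 'M[F]_m).
Hypothesis JGJ : J *m G *m J = J.
Hypothesis JQ : (J :=: kermx Q)%MS.
Implicit Types (c d : 'rV[F]_k) (x y z : 'rV[F]_n).

Lemma kernel_krylov c y : y *m J = 0 ->
  [/\ y *m comb b c *m Q = 0, y *m comb b c *m G *m comb b c *m Q = 0
    & y *m comb b c *m G *m comb b c *m G *m comb b c *m Q = 0].
Proof.
apply: (krylov_annihilation infF JGJ) => [s|]; last by apply/sub_kermxP; rewrite JQ.
by rewrite -combZ -combD.
Qed.

Lemma kernel_krylov_polar c d y : y *m J = 0 ->
  y *m comb b c *m G *m comb b d *m Q = - (y *m comb b d *m G *m comb b c *m Q).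
Proof.
move=> yJ; have [_ + _] := kernel_krylov (c + d) yJ.
have [_ cc _] := kernel_krylov c yJ; have [_ dd _] := kernel_krylov d yJ.
rewrite combD !(mulmxDl, mulmxDr) cc dd add0r addr0 => /eqP.
by rewrite addrC addr_eq0 => /eqP.
Qed.

Lemma submx_evalmxP y (u : 'rV_m) :
  reflect (exists c, u = y *m comb b c) (u <= evalmx b y)%MS.
Proof. by apply: (iffP submxP) => -[c ->]; exists c; rewrite mul_evalmx. Qed.

Lemma submx_maxP (u : 'rV_m) : reflect (u *m Q = 0) (u <= J)%MS.
Proof. by rewrite JQ; apply: sub_kermxP. Qed.

Lemma evalmx_kernel y : y *m J = 0 -> (evalmx b y <= J)%MS.
Proof.
move=> yJ; apply/row_subP => i; apply/submx_maxP.
by rewrite rowE mul_evalmx; have [-> _ _] := kernel_krylov (delta_mx 0 i) yJ.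
Qed.

(** The vectors [z] and [z *m J *m G] differ by an element of ker J, whose images lie in im J and
    are killed by [Q]. *)
Lemma mul_comb_coker c z : z *m comb b c *m Q = z *m J *m G *m comb b c *m Q.
Proof.
apply/eqP; rewrite -subr_eq0 -!mulmxBl.
have [|-> //] := @kernel_krylov c (z - z *m J *m G).
by rewrite mulmxBl -!mulmxA [J *m (G *m J)]mulmxA JGJ subrr.
Qed.

Lemma rank_evalmx_le z :
  (\rank (evalmx b z) <= r + \rank (evalmx b z *m Q))%N.
Proof.
have := mxrank_mul_ker (evalmx b z) Q.
suff : (\rank (evalmx b z :&: kermx Q) <= r)%N by lia.
by rewrite /r JQ mxrankS ?capmxSr.
Qed.

(** With [z J = x M1], polarization bounds the rank of S z modulo im J by [r - dim T], where [T] is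
    the kernel of [G M1 Q] in im J. If [dim T >= 2], the bound [2 r - 2] follows; otherwise [T] is a
    line containing the part of S z in im J, and the bound is [r]. *)
Lemma rank_evalmx_full x : x *m J = 0 -> (J <= evalmx b x)%MS ->
  forall z, (\rank (evalmx b z) <= maxn r (r + r - 2))%N.
Proof.
move=> xJ JW z; pose E := evalmx b z; rewrite leq_max.
have [zJ | zJ0] := eqVneq (z *m J) 0; first by rewrite mxrankS ?evalmx_kernel.
have /submx_evalmxP[c1 zJE] : (z *m J <= evalmx b x)%MS by rewrite (submx_trans _ JW) ?submxMl.
set M1 := comb b c1 in zJE; pose u1 := x *m M1.
have u1J : (u1 <= J)%MS by rewrite -[u1]zJE submxMl.
have [_ u1Q u1QQ] := kernel_krylov c1 xJ; rewrite -/M1 -/u1 in u1Q u1QQ.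
pose L := G *m M1 *m Q; pose T := (J :&: kermx L)%MS.
have inT (u : 'rV_m) : (u <= J)%MS -> u *m G *m M1 *m Q = 0 -> (u <= T)%MS.
  move=> uJ uL; rewrite sub_capmx uJ; apply/sub_kermxP.
  by rewrite /L !mulmxA.
have zMQ c : z *m comb b c *m Q = - (x *m comb b c *m G *m M1 *m Q).
  by rewrite mul_comb_coker zJE kernel_krylov_polar.
have rEQ : (\rank (E *m Q) <= \rank (J *m L))%N.
  suff -> : E *m Q = - (evalmx b x *m L).
    by rewrite eqmx_opp mxrankS // submxMr // evalmx_kernel.
  apply/row_matrixP => i; rewrite linearN /= !row_mul !rowE !mul_evalmx zMQ.
  by rewrite /L !mulmxA.
have rL := mxrank_mul_ker J L; rewrite -/T -/r in rL.
have u1T : (u1 <= T)%MS by exact: inT.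
have u10 : u1 != 0 by rewrite -[u1]zJE.
have T0 : (0 < \rank T)%N.
  by rewrite lt0n mxrank_eq0; apply: contraNneq u10 => T0; move: u1T; rewrite T0 submx0.
have [T2 | T1] := ltnP 1 (\rank T).
  by have := rank_evalmx_le z; rewrite -/E; lia.
have Tu1 := rank1_submx T1 u10 u1T.
suff ET : (E :&: kermx Q <= T)%MS.
  by have := mxrank_mul_ker E Q; have := mxrankS ET; rewrite -/E; lia.
apply/rV_subP => u; rewrite sub_capmx => /andP[/submx_evalmxP[c uE] /sub_kermxP uQ].
apply: (inT); first exact/submx_maxP.
set M := comb b c in uE.
have [a xM] : exists a, x *m M = a *: u1.
  have : (x *m M <= u1)%MS.
    apply: submx_trans Tu1; apply: (inT).
      by apply/submx_maxP; have [] := kernel_krylov c xJ.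
    by apply/eqP; rewrite -oppr_eq0 -zMQ -/M -uE uQ.
  by case/sub_rVP => a; exists a.
(* Subtracting [a M1] makes [N] kill [x], so it remains to treat [M1] and [N] separately. *)
pose d := c - a *: c1; pose N := comb b d.
have NE : M = a *: M1 + N.
  by rewrite /N /d combD -scaleNr combZ scaleNr addrC subrK.
have xN : x *m N = 0.
  have : x *m M = a *: u1 + x *m N by rewrite NE mulmxDr -scalemxAr.
  by rewrite xM => /eqP; rewrite addrC -subr_eq subrr eq_sym => /eqP.
have [y yJ zE] : exists2 y, y *m J = 0 & z = u1 *m G + y.
  exists (z - z *m J *m G); last by rewrite zJE addrC subrK.
  by rewrite mulmxBl -!mulmxA [J *m (G *m J)]mulmxA JGJ subrr.
have zM1 : z *m M1 *m G *m M1 *m Q = 0.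
  rewrite {1}zE !mulmxDl u1QQ add0r.
  by have [] := kernel_krylov c1 yJ.
have yN : y *m N *m G *m M1 *m Q = 0.
  have [a' yM1] : exists a', y *m M1 = a' *: u1.
    have : (y *m M1 <= u1)%MS.
      apply: submx_trans Tu1; have [h1 h2 _] := kernel_krylov c1 yJ.
      by apply: (inT) => //; apply/submx_maxP.
    by case/sub_rVP => a'; exists a'.
  rewrite kernel_krylov_polar // -/M1 yM1 -!scalemxAl kernel_krylov_polar //.
  by rewrite -/N xN !mul0mx oppr0 scaler0 oppr0.
(* By the polarized relation [N] sends [G *m im J] into im J, im J being
   exhausted by the values at [x]. *)
have JN (u' : 'rV_m) : (u' <= J)%MS -> u' *m G *m N *m Q = 0.
  move=> u'J; have /submx_evalmxP[d' ->] := submx_trans u'J JW.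
  by rewrite kernel_krylov_polar // -/N xN !mul0mx oppr0.
(* This is the only term of the third relation for [M1 + N] at [x] that is not already known to
   vanish. *)
have u1N : u1 *m G *m N *m G *m M1 *m Q = 0.
  have [_ _] := kernel_krylov (c1 + d) xJ; rewrite combD -/M1 -/N.
  rewrite [x *m (M1 + N)]mulmxDr xN addr0 -/u1 => H.
  have wJ : (u1 *m G *m (M1 + N) <= J)%MS.
    by apply/submx_maxP; rewrite mulmxDr mulmxDl u1Q JN // addr0.
  move: H; rewrite mulmxDr mulmxDl (JN _ wJ) addr0.
  by rewrite mulmxDr !mulmxDl u1QQ add0r.
rewrite uE NE mulmxDr -scalemxAr !mulmxDl -!scalemxAl zM1 scaler0 add0r.
by rewrite {1}zE !mulmxDl u1N yN addr0.
Qed.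

Lemma rank_quotient_drop x (P : 'M_m) r1 r2 :
    x *m J = 0 -> evalmx b x != 0 -> ~~ (J <= evalmx b x)%MS ->
    (evalmx b x :=: kermx P)%MS ->
    kernel_spanning (fun i => b i *m P) r1 ->
    (exists c, \rank (comb b c *m Q) = r2) ->
  (r1 + 2 <= r)%N \/ (r2 + 2 <= r)%N.
Proof.
move=> xJ W0 JW WP [r1max sp1] [c2 r2E].
have [r1s|r1l] := leqP (r1 + 2) r; first by left.
have [r2s|r2l] := leqP (r2 + 2) r; first by right.
exfalso.
have JP : J *m P != 0 by apply: contra JW => /eqP JP; rewrite WP; apply/sub_kermxP.
(* A nonzero column of [J *m P] is a linear form on the source; a vector [v] outside its kernel has
   [v J] outside W. *)
have [j Jj] : exists j, J *m col j P != 0.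
  apply: not_all_not_ex => H; case/eqP: JP; apply/matrixP => i j.
  move/negP: (H j); rewrite negbK colE mulmxA -colE => /eqP/colP/(_ i).
  by rewrite [LHS]mxE => ->; rewrite !mxE.
have [c1 [y [r1E yP yl]]] := sp1 _ Jj; rewrite combMr in r1E yP.
have g1 : (r1 < \rank (row_mx (comb b c1 *m P) (J *m col j P)))%N.
  by rewrite -r1E; apply/rank_row_mx_gt; exists y.
have g2 : (r2 <= \rank (1%:M *m comb b c2 *m Q))%N by rewrite mul1mx r2E.
have [c4 g4] : exists c, (0 < \rank (x *m comb b c *m 1%:M))%N.
  apply: not_all_not_ex => H; case/eqP: W0; apply/row_matrixP => i.
  move/negP: (H (delta_mx 0 i)); rewrite -eqn0Ngt mxrank_eq0 mulmx1 => /eqP.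
  by rewrite rowE mul_evalmx row0.
have [c [c1P [c2P c4P]]] := generic_ex (generic_and infF (generic_rank (affine_row_mx _ _ _) g1)
  (generic_and infF (generic_rank (affine_combM _ _ _) g2)
                    (generic_rank (affine_combM _ _ _) g4))).
rewrite mul1mx in c2P; rewrite mulmx1 lt0n mxrank_eq0 in c4P.
set M := comb b c in c1P c2P c4P; pose w := x *m M.
pose T := (J :&: kermx (G *m M *m Q))%MS.
have rMQ : (\rank (M *m Q) <= \rank (J *m (G *m M *m Q)))%N.
  suff -> : M *m Q = J *m (G *m M *m Q) by [].
  by apply/row_matrixP => i; rewrite !row_mul !rowE !mulmxA mul_comb_coker.
have T1 : (\rank T <= 1)%N.
  by have := mxrank_mul_ker J (G *m M *m Q); rewrite -/T -/r; lia.
have inT (u : 'rV_m) : u *m Q = 0 -> u *m G *m M *m Q = 0 -> (u <= T)%MS.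
  move=> uJ uL; rewrite sub_capmx; apply/andP; split; first exact/submx_maxP.
  by apply/sub_kermxP; rewrite !mulmxA.
have [wQ wQ1 wQ2] := kernel_krylov c xJ; rewrite -/M -/w in wQ wQ1 wQ2.
have Tw := rank1_submx T1 c4P (inT _ wQ wQ1).
have wP : w *m P = 0.
  by apply/sub_kermxP; rewrite -WP; apply/submx_evalmxP; exists c.
have TP (u : 'rV_m) : u *m Q = 0 -> u *m G *m M *m Q = 0 -> u *m P = 0.
  move=> uQ uL; have := submx_trans (inT _ uQ uL) Tw; case/sub_rVP => a ->.
  by rewrite -scalemxAl wP scaler0.
have kerJ : (kermx J <= kermx (M *m P))%MS.
  apply/rV_subP => u /sub_kermxP uJ; apply/sub_kermxP; rewrite mulmxA.
  by have [uQ uL _] := kernel_krylov c uJ; apply: TP.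
have rMP : (\rank (M *m P) <= r1)%N by rewrite -combMr.
have [v vP vl] : exists2 v : 'rV_n, v *m (M *m P) = 0 & v *m (J *m col j P) != 0.
  by apply/rank_row_mx_gt; apply: leq_ltn_trans rMP c1P.
have wGJ : w *m G *m J = w.
  have /submxP[t wt] : (w <= J)%MS by apply/submx_maxP.
  by rewrite wt -!mulmxA [J *m (G *m J)]mulmxA JGJ.
have K2 : (col_mx v (w *m G) <= kermx (M *m P))%MS.
  rewrite col_mx_sub; apply/andP; split; apply/sub_kermxP => //.
  by rewrite mulmxA TP.
(* The images [v J] and [w] are independent since [P] kills [w] but not [v J]. So ker (M P) has at
   least two dimensions more than ker J. *)
have r2K : (1 < \rank (col_mx v (w *m G) *m J))%N.
  rewrite mul_col_mx wGJ -addsmxE.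
  rewrite ltnNge; apply: contra vl => le1.
  have /(submx_trans (addsmxSl _ _))/sub_rVP[a vJ] := rank1_submx le1 c4P (addsmxSr _ _).
  by rewrite mulmxA vJ -scalemxAl colE mulmxA wP mul0mx scaler0.
have := mxrank_mul_ker (kermx (M *m P)) J.
have := mxrankS (submxMr J K2).
have : (\rank (kermx J) <= \rank (kermx (M *m P) :&: kermx J))%N.
  by rewrite mxrankS // sub_capmx kerJ submx_refl.
rewrite !mxrank_ker -/r.
have := rank_leq_row J; have := rank_leq_row (M *m P).
have : (r <= r1.+1)%N by lia.
(* The extra column in [c1P] accounts for at most one unit of rank. *)
have : (r1 <= \rank (M *m P))%N.
  have [+ _] := mxrank_adds_leqif (M *m P)^T%R (J *m col j P)^T%R.
  rewrite addsmxE -tr_row_mx !mxrank_tr.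
  move=> /(leq_trans c1P) h; rewrite -ltnS -[X in (_ < X)%N]addn1; apply: leq_trans h _.
  by rewrite leq_add2l rank_leq_col.
rewrite -/r; lia.
Qed.

End KernelVector.

(** * The induction on the maximal rank *)

Lemma eqmx_ker_coker (F : fieldType) p q (A : 'M[F]_(p, q)) :
  (A :=: kermx (cokermx A))%MS.
Proof.
apply/eqmxP/andP; split; last by rewrite submxE mulmx_ker.
by apply/sub_kermxP; rewrite mulmx_coker.
Qed.

Lemma rank_evalmx_quotient (F : fieldType) n m k (b : 'I_k -> 'M[F]_(n, m)) (P : 'M_m) z :
  (\rank (evalmx b z) <= \rank (kermx P) + \rank (evalmx (fun i => b i *m P) z))%N.
Proof.
rewrite evalmxMr -(mxrank_mul_ker (evalmx b z) P) addnC leq_add2r.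
by rewrite mxrankS // capmxSr.
Qed.

Theorem rank_evalmx_bound (F : fieldType) n m k r (b : 'I_k -> 'M[F]_(n, m)) :
    (forall p : {poly F}, p != 0 -> exists s, p.[s] != 0) ->
  kernel_spanning b r ->
  forall z, (4 * \rank (evalmx b z) <= r.+1 ^ 2)%N.
Proof.
move=> infF; elim/ltn_ind: r b => r IH b bS z.
have [-> | Ez] := eqVneq (evalmx b z) 0; first by rewrite mxrank0 muln0.
have [rb sb] := bS.
have [c0 [x [rJ xJ Wx]]] : exists c x,
    [/\ \rank (comb b c) = r, x *m comb b c = 0 & evalmx b x != 0].
  have [i [j zij]] : exists i j, evalmx b z i j != 0.
    apply: NNPP => H; case/eqP: Ez; apply/matrixP => i j; rewrite [RHS]mxE.
    by apply/eqP/negP => /negP ij; apply: H; exists i, j.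
  have colE' (y : 'rV_n) : (y *m col j (b i)) 0 0 = evalmx b y i j.
    by rewrite !mxE; apply: eq_bigr => l _; rewrite !mxE.
  (* This column is a linear form that is nonzero at [z]; a kernel vector [x] on which it is nonzero
     has S x nonzero. *)
  have [|c [x [cr cx xl]]] := sb (col j (b i)).
    by apply: contraNneq zij => h; rewrite -colE' h mulmx0 mxE.
  exists c, x; split=> //; apply: contraNneq xl => W0.
  by apply/eqP/matrixP => u v; rewrite !ord1 colE' W0 !mxE.
subst r; set J := comb b c0 in rb sb xJ IH bS.
have JGJ : J *m pinvmx J *m J = J by exact: mulmxKpV.
have JQ := eqmx_ker_coker J.
have WJ : (evalmx b x <= J)%MS by exact: (evalmx_kernel infF rb JGJ JQ).
have [JW | JW] := boolP (J <= evalmx b x)%MS.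
  (* [(r + 1)^2] exceeds [4 r] by [(r - 1)^2] and [4 (2 r - 2)] by [(r - 3)^2]. *)
  by have := rank_evalmx_full infF rb JGJ JQ xJ JW z; rewrite -/J; nia.
have WP := eqmx_ker_coker (evalmx b x).
have [c1 S1] := kernel_spanning_mulmx (cokermx (evalmx b x)) infF bS.
have [c2 S2] := kernel_spanning_mulmx (cokermx J) infF bS.
have step (P : 'M_m) r' : (\rank (kermx P) <= \rank J)%N -> (r' + 2 <= \rank J)%N ->
    kernel_spanning (fun i => b i *m P) r' -> (4 * \rank (evalmx b z) <= (\rank J).+1 ^ 2)%N.
  move=> rP r'J SP; have := rank_evalmx_quotient b P z.
  have r'l : (r' < \rank J)%N by lia.
  by have := IH r' r'l _ SP z; nia.
have [] := rank_quotient_drop infF rb JGJ JQ xJ Wx JW WP S1 (ex_intro _ c2 erefl).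
  by move=> h; apply: step S1 => //; rewrite -WP mxrankS.
by move=> h; apply: step S2 => //; rewrite -JQ.
Qed.

(** * Extension of scalars to the rational function field *)

Section BaseChange.
Variables (K L : fieldType) (f : {rmorphism K -> L}) (n m k : nat).
Variable b : 'I_k -> 'M[K]_(n, m).
Let bL i := map_mx f (b i).

Lemma map_comb c : map_mx f (comb b c) = comb bL (map_mx f c).
Proof. by rewrite raddf_sum; apply: eq_bigr => i _ /=; rewrite map_mxZ mxE. Qed.

Lemma map_evalmx x : map_mx f (evalmx b x) = evalmx bL (map_mx f x).
Proof. by apply/row_matrixP => i; rewrite -map_row !rowK map_mxM. Qed.

Lemma rank_comb_map r (s : seq K) : uniq s -> (r < size s)%N ->
  (forall c, \rank (comb b c) <= r)%N -> forall c, (\rank (comb bL c) <= r)%N.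
Proof.
move=> us rs rb.
(* Coordinates are freed one at a time: those of index at least [j] still come from K. Each new one
   spans a pencil controlled at more than [r] values of K. *)
suff H j (c : 'rV[L]_k) : (forall i : 'I_k, (j <= i)%N -> exists a, c 0 i = f a) ->
    (\rank (comb bL c) <= r)%N.
  by move=> c; apply: (H k) => i; rewrite leqNgt ltn_ord.
elim: j c => [|j IH] c cj.
  have [g gE] : exists g : 'I_k -> K, forall i, c 0 i = f (g i).
    by apply: (fin_all_exists (P := fun i a => c 0 i = f a)) => i; apply: cj.
  have -> : c = map_mx f (\row_i g i) by apply/rowP => i; rewrite !mxE gE.
  by rewrite -map_comb mxrank_map.
have [jk | kj] := ltnP j k; last first.
  by apply: IH => i ji; have := ltn_ord i; rewrite ltnNge (leq_trans kj).
pose i0 := Ordinal jk; pose e : 'rV[L]_k := delta_mx 0 i0.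
have combe : comb bL e = bL i0.
  rewrite /comb (bigD1 i0) //= !mxE !eqxx scale1r big1 ?addr0 // => i ii0.
  by rewrite !mxE (negPf ii0) andbF scale0r.
have cE a : comb bL (c - c 0 i0 *: e + a *: e) = comb bL (c - c 0 i0 *: e) + a *: bL i0.
  by rewrite combD combZ combe.
have := rank_pencil (r := r) (s := map f s) (X := comb bL (c - c 0 i0 *: e)) (Y := bL i0).
rewrite map_inj_uniq ?size_map; last exact: fmorph_inj.
move=> /(_ us rs) H; have := H _ _ (c 0 i0); rewrite -cE subrK; apply.
  rewrite /bL mxrank_map; have := rb (delta_mx 0 i0).
  suff -> : comb b (delta_mx 0 i0) = b i0 by [].
  rewrite /comb (bigD1 i0) //= !mxE !eqxx scale1r big1 ?addr0 // => i ii0.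
  by rewrite !mxE (negPf ii0) andbF scale0r.
move=> _ /mapP[a _ ->]; rewrite -cE; apply: IH => i ji; rewrite !mxE.
have [-> | ii0] := eqVneq i i0.
  by exists a; rewrite !mulr1 subrr add0r.
have [|d ->] := cj i; last by exists d; rewrite !mulr0 subr0 addr0.
rewrite ltn_neqAle ji andbT; apply: contraNneq ii0 => ji'.
by apply/eqP/val_inj.
Qed.

(** If [l] killed every kernel vector defined over K, then [n] independent ones would form an
    invertible [X] with [X l = 0], forcing [l = 0]. *)
Lemma kernel_spanning_map r (s : seq K) : uniq s -> (r < size s)%N ->
  kernel_spanning b r -> kernel_spanning bL r.
Proof.
move=> us rs [rb sb]; split; first exact: rank_comb_map us rs rb.
move=> l l0; apply: NNPP => noc.
have kl c (x : 'rV_n) : \rank (comb b c) = r -> x *m comb b c = 0 -> map_mx f x *m l = 0.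
  move=> cr cx; apply/eqP/negP => /negP xl; apply: noc.
  exists (map_mx f c), (map_mx f x).
  by rewrite -map_comb mxrank_map -map_mxM cx map_mx0.
have [X [rX Xl]] : exists X : 'M[K]_n, (n <= \rank X)%N /\ map_mx f X *m l = 0.
  suff H p : (p <= n)%N -> exists X : 'M[K]_n, (p <= \rank X)%N /\ map_mx f X *m l = 0.
    exact: H.
  elim: p => [_|p IH pn]; first by exists 0; rewrite map_mx0 mul0mx.
  have [X [pX Xl]] := IH (ltnW pn).
  have [|Xn] := ltnP p (\rank X); first by exists X.
  have : cokermx X != 0 by rewrite -mxrank_eq0 mxrank_coker -lt0n; lia.
  move=> cX; have [j cj] : exists j, col j (cokermx X) != 0.
    apply: not_all_not_ex => H; case/eqP: cX; apply/matrixP => i j.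
    move/negP: (H j); rewrite negbK => /eqP/colP/(_ i).
    by rewrite mxE => ->; rewrite !mxE.
  have [c [x [cr cx xj]]] := sb _ cj.
  exists (X + x)%MS; split.
    apply: (leq_ltn_trans pX); apply: rank_ltmx; rewrite ltmxE addsmxSl /=.
    apply: contra xj => /(submx_trans (addsmxSr _ _)); rewrite submxE => /eqP xX.
    by rewrite colE mulmxA xX mul0mx.
  apply/sub_kermxP; rewrite map_addsmx addsmx_sub; apply/andP.
  by split; apply/sub_kermxP => //; apply: kl cr cx.
case/eqP: l0; rewrite -[l](@mulKmx _ _ _ (map_mx f X)) ?Xl ?mulmx0 //.
by rewrite map_unitmx -row_full_unit /row_full eqn_leq rank_leq_col.
Qed.

End BaseChange.

Lemma fraction_poly_infinite (K : fieldType) (p : {poly {fraction {poly K}}}) :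
  p != 0 -> exists s, p.[s] != 0.
Proof.
move=> p0; apply: NNPP => no.
pose g (i : nat) : {fraction {poly K}} := tofrac ('X^i).
have ginj : injective g.
  move=> i j /eqP; rewrite tofrac_eq => /eqP /(congr1 (fun q : {poly K} => size q)).
  by rewrite !size_polyXn => -[].
have := max_poly_roots p0 (rs := map g (iota 0 (size p))).
rewrite map_inj_uniq // iota_uniq size_map size_iota ltnn => H.
suff : false by []. apply: H => //; apply/allP => _ /mapP[i _ ->].
by apply/negP => /negP pi; apply: no; exists (g i).
Qed.

Theorem rank_evalmx_bound_card (K : fieldType) n m k r (b : 'I_k -> 'M[K]_(n, m)) (s : seq K) :
  uniq s -> (r < size s)%N -> kernel_spanning b r ->
  forall z, (4 * \rank (evalmx b z) <= r.+1 ^ 2)%N.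
Proof.
move=> us rs bS z.
pose f : {rmorphism K -> {fraction {poly K}}} := (@tofrac {poly K} \o polyC).
rewrite -(mxrank_map f) map_evalmx.
apply: rank_evalmx_bound; first exact: fraction_poly_infinite.
exact: kernel_spanning_map us rs bS.
Qed.

(** * From semi-primitive spaces to families with spanning kernels *)

Lemma decPP P : reflect P (Defs.decP P).
Proof.
by apply: (iffP idP); rewrite /Defs.decP; case: constructive_indefinite_description => x /= [].
Qed.

Lemma natmax_spec (P : nat -> Prop) b :
  (exists2 k, k <= b & P k)%N ->
  P (natmax P b) /\ forall k, (k <= b)%N -> P k -> (k <= natmax P b)%N.
Proof.
case=> k kb Pk; split; last first.
  move=> j jb Pj.
  by apply: (leq_bigmax_cond (Ordinal (jb : j < b.+1)%N)); apply/decPP.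
have [|i Pi iE] := @eq_bigmax_cond 'I_b.+1 (fun i => Defs.decP (P i)) (fun i => i : nat).
  by apply/card_gt0P; exists (Ordinal (kb : k < b.+1)%N); apply/decPP.
by rewrite /natmax [X in P X]iE; apply/decPP.
Qed.

Section Connection.
Variables (K : fieldType) (m n : nat).

Lemma vspace_mx p (V : {vspace 'cV[K]_p}) : exists A : 'M_(\dim V, p),
  \rank A = \dim V /\ forall v, (v \in V) = (v^T <= A)%MS.
Proof.
pose A := \matrix_(i < \dim V) ((vbasis V)`_i)^T.
have mulA c : c *m A = (\sum_i c 0 i *: (vbasis V)`_i)^T.
  rewrite mulmx_sum_row linear_sum; apply: eq_bigr => i _.
  by rewrite rowK linearZ.
exists A; split.
  apply/eqP/inj_row_free => c /eqP; rewrite mulA -trmx0 (inj_eq trmx_inj) => /eqP c0.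
  by apply/rowP => i; rewrite mxE; move: i; apply: (freeP _ _ c0); apply: basis_free (vbasisP V).
move=> v; apply/idP/idP => [/coord_vbasis vE | /submxP[c]].
  apply/submxP; exists (\row_i coord (vbasis V) i v).
  by rewrite mulA {1}vE; congr (_^T); apply: eq_bigr => i _; rewrite mxE.
rewrite mulA => /trmx_inj ->; apply: memv_suml => i _.
by rewrite memvZ // vbasis_mem // mem_nth // size_tuple.
Qed.

Lemma dim_vspace_mx p q (V : {vspace 'cV[K]_p}) (A : 'M_(q, p)) :
  (forall v, (v \in V) = (v^T <= A)%MS) -> \dim V = \rank A.
Proof.
move=> VA; have [B [rB VB]] := vspace_mx V; rewrite -rB.
by apply/eqmx_rank/andP; split; apply/rV_subP => u;
   rewrite -[u]trmxK -VA -VB.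
Qed.

Lemma mem_opker p q (M : 'M[K]_(p, q)) v : (v \in opker M) = (v^T <= kermx M^T)%MS.
Proof.
rewrite memv_ker lfunE /=; apply/eqP/sub_kermxP; rewrite -trmx_mul.
  by move=> ->; rewrite trmx0.
by move/(congr1 trmx); rewrite trmxK trmx0.
Qed.

Lemma dim_opker p q (M : 'M[K]_(p, q)) : \dim (opker M) = (q - \rank M)%N.
Proof. by rewrite (dim_vspace_mx (mem_opker M)) mxrank_ker mxrank_tr. Qed.

Variable S : {vspace 'M[K]_(m, n)}.
Let b (i : 'I_(\dim S)) : 'M[K]_(n, m) := ((vbasis S)`_i)^T.

Lemma comb_vbasis c : comb b c = (\sum_i c 0 i *: (vbasis S)`_i)^T.
Proof. by rewrite linear_sum; apply: eq_bigr => i _; rewrite linearZ. Qed.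

Lemma comb_mem c : (comb b c)^T \in S.
Proof.
rewrite comb_vbasis trmxK; apply: memv_suml => i _.
by rewrite memvZ // vbasis_mem // mem_nth // size_tuple.
Qed.

Lemma mem_comb M : M \in S -> exists c, M^T = comb b c.
Proof.
move=> /coord_vbasis ME; exists (\row_i coord (vbasis S) i M).
by rewrite comb_vbasis {1}ME; congr (_^T); apply: eq_bigr => i _; rewrite mxE.
Qed.

Lemma dim_evalsp x : \dim (evalsp S x) = \rank (evalmx b x^T).
Proof.
apply: dim_vspace_mx => v; apply/memv_imgP/submxP => [[M MS ->] | [c vE]].
  have [c cE] := mem_comb MS; exists c.
  by rewrite mul_evalmx lfunE /= trmx_mul cE.
exists (comb b c)^T; first exact: comb_mem.
by rewrite lfunE /= -[v]trmxK vE mul_evalmx trmx_mul !trmxK.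
Qed.

Lemma urk_spec : (exists2 M, M \in S & \rank M = urk S) /\
  forall M, M \in S -> (\rank M <= urk S)%N.
Proof.
have [|urkE urkM] := @natmax_spec (fun k => exists2 M, M \in S & \rank M = k) (minn m n).
  by exists 0%N => //; exists 0; rewrite ?mem0v ?mxrank0.
split=> // M MS; apply: urkM; last by exists M.
by rewrite leq_min rank_leq_row rank_leq_col.
Qed.

Lemma trk_spec : exists x, trk S = \dim (evalsp S x).
Proof.
have [|[x xE] _] := @natmax_spec (fun k => exists x : 'cV[K]_n, \dim (evalsp S x) = k) m.
  exists (\dim (evalsp S 0)); last by exists 0.
  by rewrite dim_evalsp rank_leq_col.
by exists x; rewrite xE.
Qed.

Lemma defect_index_le : (defect_index S <= n - urk S)%N.
Proof.
have [|dS _] := @natmax_spec (defective S) n; first by exists 0%N.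
by have [[M MS <-] _] := urk_spec; rewrite -dim_opker; apply: dS.
Qed.

(** If a form [l] vanished on the kernels of all elements of maximal rank, its kernel would be a
    hyperplane forbidden by semi-primitivity. *)
Lemma semi_primitive_kernel_spanning : semi_primitive S -> kernel_spanning b (urk S).
Proof.
case=> _ noU; have [_ rS] := urk_spec; split.
  by move=> c; rewrite -mxrank_tr rS // comb_mem.
move=> l l0; apply: NNPP => noc; apply: noU.
have rl : \rank l = 1%N.
  by apply/eqP; rewrite eqn_leq rank_leq_col lt0n mxrank_eq0.
have n0 : (0 < n)%N by rewrite -rl rank_leq_row.
exists (opker l^T); split; first by rewrite dim_opker mxrank_tr rl; lia.
move=> M MS; apply: leq_trans defect_index_le _.
have -> : \dim (opker l^T :&: opker M) = \rank (kermx l :&: kermx M^T)%MS.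
  by apply: dim_vspace_mx => v; rewrite memv_cap !mem_opker trmxK sub_capmx.
have [rM | rM] := eqVneq (\rank M) (urk S).
  suff /mxrankS : (kermx M^T <= kermx l :&: kermx M^T)%MS by rewrite mxrank_ker mxrank_tr rM.
  rewrite sub_capmx submx_refl andbT; apply/rV_subP => u /sub_kermxP uM.
  apply/sub_kermxP/eqP/negP => /negP ul; apply: noc.
  have [c cE] := mem_comb MS; exists c, u.
  by rewrite -cE mxrank_tr rM.
(* An element of smaller rank has a spare kernel dimension, and the hyperplane costs at most one. *)
have := mxrank_sum_cap (kermx l) (kermx M^T); have := rank_leq_col (kermx l + kermx M^T)%MS.
rewrite !mxrank_ker mxrank_tr rl; have := rS M MS; have := rank_leq_col M; lia.
Qed.

Lemma trk_bound (s : seq K) : semi_primitive S -> uniq s -> (urk S < size s)%N ->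
  (4 * trk S <= (urk S).+1 ^ 2)%N.
Proof.
move=> /semi_primitive_kernel_spanning bS us rs; have [x ->] := trk_spec.
by rewrite dim_evalsp; apply: rank_evalmx_bound_card us rs bS _.
Qed.

End Connection.

(** * Comparison of the quadratic and binomial bounds *)

Theorem mainTheorem8 (K : fieldType) (m n : nat) (S : {vspace 'M[K]_(m, n)}) :
  semi_primitive S ->
  (2 <= urk S)%N ->
  (exists s : seq K, uniq s /\ (urk S < size s)%N) ->
  (trk S <= 6 + 'C(urk S - 2, 2))%N.
Proof.
move=> semiS r2 [s [us rs]]; have := trk_bound semiS us rs.
move: (trk S) (urk S) r2 => t r r2 tr.
have := mul_bin_diag (r - 2) 1; rewrite bin1.
case: r r2 tr => [|[|k]] // _ tr; rewrite !subSS subn0.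
set B := 'C(k, 2); clearbody B => kB.
(* As [2 B = k (k - 1)], the bound [(k + 3)^2 <= 4 (6 + B)] amounts to [(k - 3) (k - 5) >= 0]. It
   fails only at [k = 4], where [4 t <= 49] still gives [t <= 12 = 6 + B]. *)
have [k4 | k4] := eqVneq k 4; first by subst k; lia.
have : (k <= 3 \/ 5 <= k)%N by lia.
by case=> ?; nia.
Qed.
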